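(* Let $G$ be a graph, $v_0\in V(G)$, $t\geq 2$, and let $G(v_0)+\{P_{n_1},P_{n_2},\dots,P_{n_t}\}$ be the graph obtained from $G$ by attaching pairwise disjoint paths $P_{n_1},\dots,P_{n_t}$ to $v_0$. Let $i\neq j$ be in $\{1,\dots,t\}$. Then there exists a minimal perfect critical vertex set $S$ of $G(v_0)+\{P_{n_1},\dots,P_{n_t}\}$ with $S\subset V(P_{n_i})\cup V(P_{n_j})$ if and only if $2n_i+1$ and $2n_j+1$ have a common divisor greater than $1$.
   Context: Graphs are finite, simple, undirected, unweighted. The graph $G(v_0)+\{P_{n_1},\dots,P_{n_t}\}$ is formed as follows: for each $l=1,\dots,t$, $P_{n_l}$ is a path with $n_l\ge 1$ vertices $v^{(l)}_1,\dots,v^{(l)}_{n_l}$ (consecutive ones adjacent); the paths are vertex-disjoint from each other and from $G$; the graph is the disjoint union of $G$ and these paths together with the additional edges $v_0v^{(l)}_{n_l}$, $l=1,\dots,t$. For a graph with vertex set $V$ let $\mathbf{L}$ be its Laplacian (degree matrix minus adjacency matrix); for $S\subset V$, $\overline{S}=V\setminus S$; for a vector $\mathbf{y}$ indexed by $V$, $\mathbf{y}|_S$ is its restriction to coordinates in $S$. A nonempty $S\subset V$ is a perfect critical vertex set if there is an eigenvector $\mathbf{y}$ of $\mathbf{L}$ with $\mathbf{y}|_{\overline S}=\mathbf{0}$ and $\mathbf{y}|_{\{v\}}\neq 0$ for every $v\in S$. It is minimal if no proper subset of it is a perfect critical vertex set. *)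

(* Defs.v *)
From HB Require Import structures.
From mathcomp Require Import all_boot all_order all_algebra reals.

Set Implicit Arguments.
Unset Strict Implicit.
Unset Printing Implicit Defensive.

Import Order.TTheory GRing.Theory Num.Theory.
Local Open Scope ring_scope.

Record sgraph := SGraph {
  vertex :> finType;
  adj : rel vertex;
  adj_sym : symmetric adj;
  adj_irrefl : irreflexive adj }.

Definition degree (G : sgraph) (v : G) : nat := #|[set w | adj v w]|.

(* Matrices and vectors indexed by the vertices use the bijection
   enum_rank / enum_val between G and 'I_#|G|. *)

Definition degree_mx (R : realType) (G : sgraph) : 'M[R]_#|G| :=
  diag_mx (\row_i (degree (enum_val i))%:R).

Definition adj_mx (R : realType) (G : sgraph) : 'M[R]_#|G| :=
  \matrix_(i, j) (adj (enum_val i) (enum_val j))%:R.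

Definition laplacian (R : realType) (G : sgraph) : 'M[R]_#|G| :=
  degree_mx R G - adj_mx R G.

Definition is_eigenvector (R : realType) (m : nat)
    (A : 'M[R]_m) (y : 'cV[R]_m) : Prop :=
  y != 0 /\ exists lambda : R, A *m y = lambda *: y.

Definition perfect_critical (R : realType) (G : sgraph) (S : {set G}) : Prop :=
  S != set0 /\
  exists y : 'cV[R]_#|G|,
    [/\ is_eigenvector (laplacian R G) y,
        forall v : G, v \in ~: S -> y (enum_rank v) 0 = 0
      & forall v : G, v \in S -> y (enum_rank v) 0 != 0].

Definition minimal_perfect_critical (R : realType) (G : sgraph)
    (S : {set G}) : Prop :=
  perfect_critical R S /\
  forall S' : {set G}, S' \proper S -> ~ perfect_critical R S'.

Section AttachPaths.

Variables (G : sgraph) (v0 : G) (t : nat) (n : 'I_t -> nat).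

(* [inr (Tagged _ k)] with tag [l] and [k : 'I_(n l)] is the vertex
   v^(l)_(k+1): positions are counted from 0, so the vertex joined to [v0]
   is the one with k + 1 = n l. *)
Definition attach_vertex : finType := (G + {l : 'I_t & 'I_(n l)})%type.

Definition attach_adj : rel attach_vertex := fun x y =>
  match x, y with
  | inl u, inl w => adj u w
  | inl u, inr p | inr p, inl u =>
      (u == v0) && ((tagged p).+1 == n (tag p))
  | inr p, inr q =>
      (tag p == tag q) &&
      (((tagged p).+1 == tagged q :> nat) || ((tagged q).+1 == tagged p :> nat))
  end.

Lemma attach_adj_sym : symmetric attach_adj.
Proof.
move=> [u|p] [w|q] //=; first exact: adj_sym.
by rewrite eq_sym orbC.
Qed.

Lemma attach_adj_irrefl : irreflexive attach_adj.
Proof.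
move=> [u|p] /=; first exact: adj_irrefl.
by rewrite eqxx orbb /= eqn_leq ltnn.
Qed.

Definition attach_paths : sgraph := SGraph attach_adj_sym attach_adj_irrefl.

Definition path_vertices (l : 'I_t) : {set attach_paths} :=
  [set (inr (Tagged (fun l => 'I_(n l)) k) : attach_paths) | k : 'I_(n l)].

End AttachPaths.

(* Main.v *)
(* An eigenvector for the eigenvalue 2 - x supported on two of the paths vanishes
   at v0, so on each path it is a multiple of one sequence p_k(x) read off from the
   free end, and p must vanish at the position of v0 on both paths; conversely, two
   such multiples can be scaled to cancel at v0. So the question is whether
   p_(a+1) and p_(b+1), a = n_i, b = n_j, have a common real root. As
   p_k(2 cos 2f) = cos((2k-1)f) / cos f, a common divisor d of 2a+1 and 2b+1 gives
   the root with f = pi/(2d). Conversely p, indexed by the odd numbers 2k-1, is even,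
   and odd about each of its zeros, so its zeros are stable under Euclid's algorithm. *)
Require Import Defs.
From HB Require Import structures.
From mathcomp Require Import all_boot all_order all_algebra reals.
From mathcomp Require Import boolp trigo zify ring.

Set Implicit Arguments.
Unset Strict Implicit.
Unset Printing Implicit Defensive.

(** * The entries along a path: symmetries and real zeros *)

Section Profile.

Import Order.TTheory GRing.Theory Num.Theory.
Local Open Scope ring_scope.

(* [profile x k] is the entry at v^(l)_k; index 0 is a ghost vertex before the free
   end, equal to v^(l)_1 so that the recurrence also holds at the end of degree 1. *)
Fixpoint profile (R : nzRingType) (x : R) (k : nat) : R :=
  if k is k'.+1 then
    if k' is k''.+1 then x * profile x k' - profile x k'' else 1
  else 1.

Lemma profileSS (R : nzRingType) (x : R) k :
  profile x k.+2 = x * profile x k.+1 - profile x k.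
Proof. by []. Qed.

(** Two consecutive zeros would propagate down the recurrence to [profile x 0 = 1]. *)
Lemma profile_neq0 (R : nzRingType) (x : R) m :
  profile x m.+1 = 0 -> profile x m != 0.
Proof.
elim: m => [|m IHm] pm1; first exact: oner_neq0.
apply/eqP => pm; have := IHm pm; rewrite -oppr_eq0.
by have := pm1; rewrite profileSS pm mulr0 sub0r => ->; rewrite eqxx.
Qed.

(** The recurrence is invariant under reversal of indices, so a zero at [b.+1] makes its solution
    odd about [b.+1]. *)
Lemma profile_antisym (R : comNzRingType) (x : R) b s :
  profile x b.+1 = 0 -> (s <= b.+1)%N ->
  profile x (b.+1 + s) = - profile x (b.+1 - s).
Proof.
move=> pb; suff H : (s <= b.+1 -> profile x (b.+1 + s) = - profile x (b.+1 - s))%N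
   /\ (s < b.+1 -> profile x (b.+1 + s.+1) = - profile x (b.+1 - s.+1))%N by case: H.
elim: s => [|s [IH0 IH1]].
  by split=> _; rewrite ?addn0 ?subn0 ?pb ?oppr0 // addn1 subn1 profileSS pb mulr0 sub0r.
split=> // sb.
have -> : (b.+1 + s.+2 = (b.+1 + s).+2)%N by lia.
rewrite profileSS -addnS IH1 ?(ltnW sb) // IH0 ?(ltnW (ltnW sb)) //.
have -> : (b.+1 - s = (b.+1 - s.+2).+2)%N by lia.
have -> : (b.+1 - s.+1 = (b.+1 - s.+2).+1)%N by lia.
by rewrite profileSS; ring.
Qed.

(** The sequence is even about 1/2, as entries 0 and 1 agree, and odd about [b.+1]; composing both
    reflections gives a shift by [b.*2.+1] with a change of sign. *)
Lemma profile_antiperiod (R : comNzRingType) (x : R) b r :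
  profile x b.+1 = 0 -> profile x (b.*2.+2 + r) = - profile x r.+1.
Proof.
move=> pb; suff H : profile x (b.*2.+2 + r) = - profile x r.+1 /\
  profile x (b.*2.+2 + r.+1) = - profile x r.+2 by case: H.
have E0 : profile x b.*2.+2 = -1.
  have -> : b.*2.+2 = (b.+1 + b.+1)%N by lia.
  by rewrite profile_antisym // subnn.
have E1 : profile x b.*2.+1 = -1.
  have -> : b.*2.+1 = (b.+1 + b)%N by lia.
  by rewrite profile_antisym ?leqnSn // subSnn.
elim: r => [|r [IH0 IH1]].
  by rewrite addn0 addn1 E0 (profileSS _ b.*2.+1) E0 E1 (profileSS _ 0) /=; split=> //; ring.
split=> //.
have -> : (b.*2.+2 + r.+2 = (b.*2.+2 + r).+2)%N by lia.
by rewrite profileSS -addnS IH0 IH1 (profileSS _ r.+1); ring.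
Qed.

(* In terms of A = 2a+1 and B = 2b+1, the zero at B reflects the zero at A to
   one at |A - 2B|; this Euclidean step preserves gcd(A, B). *)
Lemma profile_common_root (R : comNzRingType) (x : R) a b :
  profile x a.+1 = 0 -> profile x b.+1 = 0 ->
  exists d, [/\ 1 < d, d %| 2 * a + 1 & d %| 2 * b + 1]%N.
Proof.
have [s] := ubnP (a + b)%N; elim: s a b => // s IHs a b.
wlog ba : a b / (b <= a)%N => [wl sab pa pb|].
  have /orP[ba|ab] := leq_total b a; first exact: wl.
  by have [|d [? ? ?]] := wl b a ab _ pb pa; [rewrite addnC|exists d].
rewrite ltnS => sab pa pb.
move: ba; rewrite leq_eqVlt => /orP[/eqP eab|ltba].
  subst b; exists (2 * a + 1)%N; split=> //.
  by case: a pa {sab pb} => [/eqP|a _]; [rewrite oner_eq0|lia].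
(* For [a <= b.*2] the reflected index is natural and gives 2B - A; otherwise the antiperiod gives A
   - 2B. *)
have [le_a2b|lt_2ba] := leqP a b.*2.
  have pa' : profile x (b.*2 - a).+1 = 0.
    apply/eqP; rewrite -oppr_eq0 -pa.
    have -> : (a.+1 = b.+1 + (a - b))%N by lia.
    rewrite profile_antisym //; last by lia.
    by apply/eqP; congr (- profile x _); lia.
  have [|d [d1 da db]] := IHs _ _ _ pa' pb; first by lia.
  exists d; split=> //.
  rewrite -(dvdn_addr _ da).
  have -> : (2 * (b.*2 - a) + 1 + (2 * a + 1) = 2 * (2 * b + 1))%N by lia.
  exact: dvdn_mull.
have pa' : profile x (a - b.*2.+1).+1 = 0.
  apply/eqP; rewrite -oppr_eq0 -(profile_antiperiod _ pb) -pa.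
  by apply/eqP; congr (profile x _); lia.
have [|d [d1 da db]] := IHs _ _ _ pa' pb; first by lia.
exists d; split=> //.
have -> : (2 * a + 1 = 2 * (2 * b + 1) + (2 * (a - b.*2.+1) + 1))%N by lia.
by rewrite dvdn_addr // dvdn_mull.
Qed.

(** With u = (2k+1)f, the recurrence is cos(u+2f) + cos(u-2f) = 2 cos(2f) cos u. *)
Lemma profile_cos (R : realType) (f : R) k :
  profile (2 * cos (2 * f)) k * cos f = cos ((2 * k%:R - 1) * f).
Proof.
suff H : profile (2 * cos (2 * f)) k * cos f = cos ((2 * k%:R - 1) * f) /\
  profile (2 * cos (2 * f)) k.+1 * cos f = cos ((2 * k.+1%:R - 1) * f) by case: H.
elim: k => [|k [IH0 IH1]].
  by rewrite /= !mul1r mulr0 sub0r mulN1r cosN; split=> //; congr cos; ring.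
split=> //; rewrite profileSS mulrBl -mulrA IH1 IH0.
set u := (2 * k.+1%:R - 1) * f.
have -> : (2 * k%:R - 1) * f = u - 2 * f by rewrite /u -natr1; ring.
have -> : (2 * k.+2%:R - 1) * f = u + 2 * f by rewrite /u -natr1; ring.
by rewrite cosB (cosD u); ring.
Qed.

(** The root depends on [d] alone, so it serves both paths: if 2m+1 = qd, then (2m+1)f is q times
    pi/2, with q odd. *)
Lemma profile_root_exists (R : realType) (d : nat) : (1 < d)%N ->
  exists x : R, forall m, (d %| 2 * m + 1)%N -> profile x m.+1 = 0.
Proof.
move=> d1; pose f : R := pi / (2 * d%:R).
have d0 : (0 : R) < d%:R by rewrite ltr0n ltnW.
have d0' : (d%:R : R) != 0 by rewrite gt_eqF.
(* As [d > 1], f lies strictly between 0 and pi/2. *)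
have cf : cos f != 0.
  rewrite gt_eqF // cos_gt0_pihalf //.
  have f0 : 0 < f by rewrite divr_gt0 ?pi_gt0 // mulr_gt0.
  rewrite (lt_trans _ f0) ?oppr_lt0 ?divr_gt0 ?pi_gt0 //=.
  by rewrite ltr_pM2l ?pi_gt0 // ltf_pV2 ?posrE ?mulr_gt0 // ltr_pMr // ltr1n.
exists (2 * cos (2 * f)) => m /dvdnP[q Eq].
apply: (mulIf cf); rewrite mul0r profile_cos.
have -> : (2 * m.+1%:R - 1) * f = q%:R * (pi / 2).
  have -> : 2 * m.+1%:R - 1 = (q * d)%:R :> R.
    by rewrite -Eq natrD natrM -natr1; ring.
  by rewrite /f natrM; field.
have : odd q.
  have : odd (q * d) by rewrite -Eq addn1 /= oddM.
  by rewrite oddM => /andP[].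
move=> odd_q; rewrite -(odd_double_half q) odd_q /=.
elim: (q./2) => [|h IHh]; first by rewrite mul1r cos_pihalf.
have -> : (1 + h.+1.*2)%:R * (pi / 2) = (1 + h.*2)%:R * (pi / 2) + pi :> R.
  by rewrite doubleS !natrD -[in h.*2.+2]addn2 natrD; field.
by rewrite cosDpi IHh oppr0.
Qed.

End Profile.

(** * Laplacian eigenvectors that vanish on [G] *)

Section PathEigenvectors.

Import Order.TTheory GRing.Theory Num.Theory.
Local Open Scope ring_scope.

(** Turns the matrix eigenvalue equation into one local equation per vertex. *)
Lemma laplacian_mulE (R : realType) (G : sgraph) (y : 'cV[R]_#|G|) (v : G) :
  (laplacian R G *m y) (enum_rank v) 0 =
  \sum_(w | adj v w) (y (enum_rank v) 0 - y (enum_rank w) 0).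
Proof.
rewrite sumrB sumr_const /laplacian mulmxBl !mxE; congr (_ - _).
  rewrite (bigD1 (enum_rank v)) //= !mxE eqxx mulr1n enum_rankK.
  rewrite big1 ?addr0 => [|i iv]; last first.
    by rewrite !mxE eq_sym (negPf iv) mulr0n mul0r.
  by rewrite mulr_natl /degree cardsE.
rewrite (reindex enum_rank) /=; last exact/onW_bij/enum_rank_bij.
rewrite [RHS]big_mkcond; apply: eq_bigr => w _; rewrite !mxE !enum_rankK.
by case: adj; rewrite ?mul1r ?mul0r.
Qed.

Lemma minimal_perfect_critical_exists (R : realType) (G : sgraph) (S : {set G}) :
  perfect_critical R S ->
  exists2 S' : {set G}, minimal_perfect_critical R S' & S' \subset S.
Proof.
move=> critS; pose P := [pred T : {set G} | `[< perfect_critical R T >]].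
have PS : P S by apply/asboolP.
have [S' /minsetP[/asboolP critS' minS'] sS'S] := minset_exists PS.
exists S' => //; split=> // T ltTS' /asboolP PT.
by move: (ltTS'); rewrite (minS' T PT (proper_sub ltTS')) properxx.
Qed.

Variables (R : realType) (G : sgraph) (v0 : G) (t : nat) (n : 'I_t -> nat).

Local Notation H := (attach_paths v0 n).

Definition path_vertex (l : 'I_t) (k : 'I_(n l)) : H :=
  inr (Tagged (fun l => 'I_(n l)) k).

Lemma path_verticesE l (v : H) :
  (v \in path_vertices v0 n l) = (if v is inr p then tag p == l else false).
Proof.
apply/imsetP/idP => [[k _ ->]|]; first by rewrite /= eqxx.
by case: v => // -[l' k] /= /eqP<-; exists k.
Qed.

(** Extending the path by the ghost entry [h 0] and by [v0] at index [(n l).+1] gives all its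
    vertices, both ends included, the same second difference. *)
Lemma sum_adj_path (Y : H -> R) l (h : nat -> R) (k : 'I_(n l)) :
  h 0 = h 1 -> (forall k', Y (@path_vertex l k') = h k'.+1) ->
  Y (inl v0) = h (n l).+1 ->
  \sum_(w | adj (path_vertex k) w) (Y (path_vertex k) - Y w) =
  2 * h k.+1 - h k - h k.+2.
Proof.
move=> h01 Yh Y0; rewrite big_sumType /=.
have -> : \sum_(u | (u == v0) && (k.+1 == n l)) (Y (path_vertex k) - Y (inl u)) =
   if k.+1 == n l then h k.+1 - h k.+2 else 0.
  case: eqP => kn; last by rewrite big_pred0 // => u; rewrite andbF.
  rewrite (eq_bigl (pred1 v0)) => [|u]; last by rewrite andbT.
  by rewrite big_pred1_eq Yh Y0 kn.
pose f m := h k.+1 - h m.+1.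
have -> : \sum_(q : {l' : 'I_t & 'I_(n l')} |
      (l == tag q) && ((k.+1 == tagged q) || ((tagged q).+1 == k)))
      (Y (path_vertex k) - Y (inr q)) =
    \sum_(k' < n l | (k.+1 == k') || (k'.+1 == k)) f k'.
  transitivity (\sum_(l' | l == l')
     \sum_(k' : 'I_(n l') | (k.+1 == k') || (k'.+1 == k))
        (Y (path_vertex k) - Y (path_vertex k'))).
    by rewrite sig_big_dep; apply: eq_bigr => -[l' k'] _.
  rewrite (big_pred1 l) => [|l']; last by rewrite eq_sym.
  by apply: eq_bigr => k' _; rewrite !Yh.
rewrite (bigID (fun k' : 'I_(n l) => k' == k.+1 :> nat)) /=.
have -> : \sum_(k' < n l | ((k.+1 == k') || (k'.+1 == k)) && (k' == k.+1 :> nat)) f k'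
   = if (k.+1 < n l)%N then f k.+1 else 0.
  rewrite -(big_ord1_eq +%R); apply: eq_bigl => k'; lia.
have -> : \sum_(k' < n l | ((k.+1 == k') || (k'.+1 == k)) && (k' != k.+1 :> nat)) f k'
   = h k.+1 - h k.
  (* The free end has no predecessor; the ghost difference [h 1 - h 0] is zero. *)
  have [k0|k_gt0] := posnP k.
    by rewrite k0 -h01 subrr big_pred0 // => k'; lia.
  transitivity (if (k.-1 < n l)%N then f k.-1 else 0).
    rewrite -(big_ord1_eq +%R); apply: eq_bigl => k'; lia.
  by rewrite (leq_ltn_trans (leq_pred k) (ltn_ord k)) /f prednK.
(* The next neighbour is either [v0] or on the path, so exactly one of the two conditional terms
   survives. *)
have := ltn_ord k; rewrite leq_eqVlt; case: eqP => [kn _|_ /= ->].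
  by rewrite kn ltnn; ring.
by rewrite /f; ring.
Qed.

Hypothesis n_gt0 : forall l, (0 < n l)%N.

(** Edges inside [G] join zeros; only the last path vertices contribute, and only at [v0]. *)
Lemma sum_adj_base (Y : H -> R) (h : 'I_t -> nat -> R) (u : G) :
  (forall u', Y (inl u') = 0) ->
  (forall l k, Y (@path_vertex l k) = h l k.+1) ->
  \sum_(w | adj (inl u : H) w) (Y (inl u) - Y w) =
  if u == v0 then - \sum_l h l (n l) else 0.
Proof.
move=> Y0 Yh; rewrite big_sumType /= big1 => [|u' _]; last by rewrite !Y0 subrr.
rewrite add0r Y0; case: eqP => _ /=; last by rewrite big_pred0.
transitivity (\sum_l \sum_(k : 'I_(n l) | k.+1 == n l) - h l k.+1).
  by rewrite sig_big_dep; apply: eq_bigr => -[l k] _; rewrite -[inr _]/(path_vertex k) Yh sub0r.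
rewrite -sumrN; apply: eq_bigr => l _.
have lt_n : ((n l).-1 < n l)%N by rewrite prednK.
rewrite (big_pred1 (Ordinal lt_n)) /= ?prednK // => k.
by rewrite /= -val_eqE /=; have := n_gt0 l; lia.
Qed.

(** The equations on a path determine its entries from the free end. The second condition says that
    the value reached at [v0] is 0, the third is the equation at [v0]. *)
Lemma path_eigenvectorE (Y : H -> R) (lambda : R) :
  (forall u, Y (inl u) = 0) ->
  (forall v, \sum_(w | adj v w) (Y v - Y w) = lambda * Y v) <->
  (exists c : 'I_t -> R,
    [/\ forall l k, Y (@path_vertex l k) = c l * profile (2 - lambda) k.+1,
        forall l, c l * profile (2 - lambda) (n l).+1 = 0
      & \sum_l c l * profile (2 - lambda) (n l) = 0]).
Proof.
move=> Y0; split=> [eigY|[c [Yc cn csum]]]; last first.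
  case=> [u|[l k]].
    rewrite (sum_adj_base (h := fun l m => c l * profile (2 - lambda) m)) //.
    by rewrite csum oppr0 Y0 mulr0 if_same.
  rewrite -[inr _]/(path_vertex k).
  rewrite (sum_adj_path (h := fun m => c l * profile (2 - lambda) m)) ?Y0 ?cn //.
  by rewrite Yc profileSS; ring.
pose c l := Y (path_vertex (Ordinal (n_gt0 l))).
(* Index 0 repeats the free end; the default 0 at index [(n l).+1] is the value at [v0]. *)
pose h l m := if m is m'.+1 then
   (if insub m' is Some k then Y (@path_vertex l k) else 0) else c l.
have Yh l k : Y (@path_vertex l k) = h l k.+1 by rewrite /= valK.
have h01 l : h l 0 = h l 1 by exact: (Yh l (Ordinal (n_gt0 l))).
have hn l : h l (n l).+1 = 0 by rewrite /h; case: insubP => // k; rewrite ltnn.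
have h0 l : h l 0 = c l by [].
clearbody h; have hc l m : (m <= (n l).+1)%N -> h l m = c l * profile (2 - lambda) m.
  suff Hm : ((m <= (n l).+1)%N -> h l m = c l * profile (2 - lambda) m) /\
     ((m <= n l)%N -> h l m.+1 = c l * profile (2 - lambda) m.+1) by case: Hm.
  elim: m => [|m [IH0 IH1]]; first by rewrite -h01 h0 /= mulr1.
  split=> // ltm; rewrite profileSS mulrBr mulrCA -IH1 ?(ltnW ltm) //.
  rewrite -IH0 ?(leqW (ltnW ltm)) //.
  have := eigY (path_vertex (Ordinal ltm)).
  rewrite (sum_adj_path (h := h l)) ?Y0 ?hn // Yh.
  move/eqP; rewrite -subr_eq0 /= => /eqP E; apply/eqP.
  by rewrite -subr_eq0 -oppr_eq0; apply/eqP; apply: etrans E; ring.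
exists c; split=> [l k|l|].
- by rewrite Yh hc // ltnW // ltnS.
- by rewrite -hc // hn.
- have := eigY (inl v0); rewrite (sum_adj_base _ Y0 Yh) eqxx Y0 mulr0.
  move/eqP; rewrite oppr_eq0 => /eqP E; rewrite -[RHS]E.
  by apply: eq_bigr => l _; rewrite hc.
Qed.

End PathEigenvectors.

(** * Eigenvectors supported on two of the paths *)

Section TwoPaths.

Import Order.TTheory GRing.Theory Num.Theory.
Local Open Scope ring_scope.

Variables (R : realType) (G : sgraph) (v0 : G) (t : nat) (n : 'I_t -> nat).
Hypothesis n_gt0 : forall l, (0 < n l)%N.
Variables (i j : 'I_t).
Hypothesis neq_ij : i != j.

Local Notation H := (attach_paths v0 n).
Local Notation two_paths := (path_vertices v0 n i :|: path_vertices v0 n j).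

Lemma sum_two_paths (c p : 'I_t -> R) :
  (forall l, l != i -> l != j -> c l = 0) ->
  \sum_l c l * p l = c i * p i + c j * p j.
Proof.
move=> c0; rewrite (bigD1 i) //= (bigD1 j) 1?eq_sym //= big1 ?addr0 // => l.
by case/andP=> li lj; rewrite c0 ?mul0r.
Qed.

(** A path with nonzero coefficient yields a root. If only one of the two had one, the equation at
    [v0] would force a second consecutive zero of [profile]. *)
Lemma perfect_critical_common_root (S : {set H}) :
  perfect_critical R S -> S \subset two_paths ->
  exists x : R, profile x (n i).+1 = 0 /\ profile x (n j).+1 = 0.
Proof.
case=> S0 [y [[_ [lambda Ey]] yS0 yS]] /subsetP sS.
pose Y (v : H) := y (enum_rank v) 0.
have Y0 u : Y (inl u) = 0.
  by apply: yS0; rewrite inE; apply/negP => /sS; rewrite inE !path_verticesE.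
have eigY v : \sum_(w | adj v w) (Y v - Y w) = lambda * Y v.
  by rewrite -laplacian_mulE Ey mxE.
have [c [Yc cn csum]] := (path_eigenvectorE n_gt0 lambda Y0).1 eigY.
exists (2 - lambda); set x := 2 - lambda in Yc cn csum *.
have c0 l : l != i -> l != j -> c l = 0.
  move=> li lj; have := Yc l (Ordinal (n_gt0 l)); rewrite /= mulr1 => <-.
  apply: yS0; rewrite inE; apply/negP => /sS.
  by rewrite inE !path_verticesE /= (negPf li) (negPf lj).
have {}csum : c i * profile x (n i) + c j * profile x (n j) = 0.
  by rewrite -(sum_two_paths (fun l => profile x (n l)) c0).
have root l : c l != 0 -> profile x (n l).+1 = 0.
  by move=> cl; have /eqP := cn l; rewrite mulf_eq0 (negPf cl) => /eqP.
have ci_cj : (c i != 0) = (c j != 0).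
  apply/idP/idP => cl; apply/eqP => cl'; move: csum;
    rewrite cl' mul0r ?addr0 ?add0r => /eqP;
    by rewrite mulf_eq0 (negPf cl) (negPf (profile_neq0 (root _ cl))).
suff ci : c i != 0 by split; apply: root; rewrite -?ci_cj.
have [v vS] := set0Pn _ S0; move: (yS v vS) (sS v vS).
rewrite inE !path_verticesE; case: v {vS} => // -[l k].
rewrite -[y _ _]/(Y (@path_vertex G v0 t n l k)) Yc mulf_eq0 negb_or.
by case/andP=> cl _ /orP[] /= /eqP El; [rewrite -El|rewrite ci_cj -El].
Qed.

(** The support of an eigenvector is perfect critical. It can miss path vertices where [profile]
    vanishes, hence a mere inclusion. *)
Lemma common_root_perfect_critical (x : R) :
  profile x (n i).+1 = 0 -> profile x (n j).+1 = 0 ->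
  exists2 S : {set H}, perfect_critical R S & S \subset two_paths.
Proof.
move=> pi0 pj0.
(* Crossed coefficients of opposite sign cancel at [v0]; they are nonzero by [profile_neq0]. *)
pose c l := if l == i then profile x (n j)
            else if l == j then - profile x (n i) else 0.
pose Y (v : H) := if v is inr q then c (tag q) * profile x (tagged q).+1 else 0.
have c0 l : l != i -> l != j -> c l = 0.
  by rewrite /c => /negPf-> /negPf->.
have eigY v : \sum_(w | adj v w) (Y v - Y w) = (2 - x) * Y v.
  apply: (path_eigenvectorE n_gt0 _ _).2 v => //; rewrite opprB addrC subrK.
  exists c; split=> // [l|].
    rewrite /c; case: eqP => [->|_]; first by rewrite pi0 mulr0.
    by case: eqP => [->|_]; rewrite ?mul0r // pj0 mulr0.
  rewrite (sum_two_paths (fun l => profile x (n l)) c0) /c !eqxx.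
  by rewrite (negPf (contra_neq (@esym _ _ _) neq_ij)); ring.
pose w : H := @path_vertex G v0 t n i (Ordinal (n_gt0 i)).
have Yw : Y w != 0 by rewrite /Y /c /= eqxx mulr1 profile_neq0.
exists [set v | Y v != 0]; last first.
  apply/subsetP => -[u|[l k]]; rewrite !inE ?eqxx // !path_verticesE /=.
  by apply: contraNT; rewrite negb_or => /andP[li lj]; rewrite c0 ?mul0r.
split; first by apply/set0Pn; exists w; rewrite inE.
exists (\col_k Y (enum_val k)).
split=> [|v|v]; rewrite ?inE ?mxE ?enum_rankK; [|by move/negPn/eqP|by []].
split.
  by apply/eqP => /matrixP/(_ (enum_rank w) 0); rewrite !mxE enum_rankK => /eqP; apply/negP.
exists (2 - x); apply/matrixP => k z; rewrite ord1 -(enum_valK k).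
rewrite laplacian_mulE !mxE !enum_rankK -eigY.
by apply: eq_bigr => v _; rewrite !mxE !enum_rankK.
Qed.

End TwoPaths.

Theorem theorem4 (R : realType) (G : sgraph) (v0 : G)
    (t : nat) (ht : 2 <= t)
    (n : 'I_t -> nat) (hn : forall l : 'I_t, 1 <= n l)
    (i j : 'I_t) (hij : i <> j) :
  (exists S : {set attach_paths v0 n},
      minimal_perfect_critical R S /\
      S \subset path_vertices v0 n i :|: path_vertices v0 n j)
  <->
  (exists d : nat, [/\ 1 < d, d %| 2 * n i + 1 & d %| 2 * n j + 1]).
Proof.
have neq_ij : i != j by apply/eqP.
split=> [[S [[critS _] sS]]|[d [d_gt1 di dj]]].
  have [x [rooti rootj]] := perfect_critical_common_root hn neq_ij critS sS.
  exact: profile_common_root rooti rootj.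
have [x root_x] := profile_root_exists R d_gt1.
have [S critS sS] :=
  common_root_perfect_critical v0 hn neq_ij (root_x _ di) (root_x _ dj).
have [S' critS' sS'] := minimal_perfect_critical_exists critS.
by exists S'; split=> //; apply: subset_trans sS' sS.
Qed.
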